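(* There exist finitely generated residually finite groups $\Gamma$ such that $\mathcal{D}_{\Gamma} \preceq \mathcal{R}_{\Gamma}$ but $\mathcal{D}_{\Gamma} \not\approx \mathcal{R}_{\Gamma}$, where $\mathcal{D}_{\Gamma}$ is the weakly sofic profile of $\Gamma$.
   Context: $\mathbb{N}=\{1,2,\ldots\}$. For a group $\Gamma$ generated by a finite set $S$, let $B_S(n)$ be the closed ball of radius $n$ around the identity in the word metric of $S$. Full residual finiteness growth: for $\Gamma$ residually finite, $\mathcal{R}_\Gamma^S(n)=\min\{|F| : F$ a finite group for which there is a homomorphism $\pi:\Gamma\to F$ with $\pi|_{B_S(n)}$ injective$\}$. Weakly sofic profile: $\mathcal{D}_\Gamma^S(n)$ is the minimal order $|G|$ of a finite group $G$ which carries a bi-invariant metric $d$ with values in $[0,1]$ and for which there is a map $\pi:B_S(n)\to G$ such that $d(\pi(g)\pi(h),\pi(gh))\le 1/n$ whenever $g,h,gh\in B_S(n)$, and $d(\pi(g),\pi(h))\ge 1-1/n$ whenever $g\neq h$ are elements of $B_S(n)$. Comparison: for functions $f_1,f_2$ from $\mathbb{N}$ to $(0,\infty)$, $f_1\preceq f_2$ means that there is a constant $C>0$ with $f_1(n)\le f_2(Cn)$ for all $n\in\mathbb{N}$, where functions on $\mathbb{N}$ are evaluated at real $x>0$ by $f(x)=f(\lceil x\rceil)$; $f_1\approx f_2$ means $f_1\preceq f_2$ and $f_2\preceq f_1$. Up to $\approx$ these functions are regarded as independent of the finite generating set $S$, and one writes $\mathcal{D}_\Gamma$, $\mathcal{R}_\Gamma$.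 *)

(* Defs.v *)
From HB Require Import structures.
From mathcomp Require Import all_boot all_order all_algebra all_fingroup.
From mathcomp Require Import boolp classical_sets functions cardinality reals.

Set Implicit Arguments.
Unset Strict Implicit.
Unset Printing Implicit Defensive.

Import Order.TTheory GRing.Theory Num.Theory.
Local Open Scope classical_set_scope.
Local Open Scope ring_scope.

(* Closed ball of radius n about 1 in the word metric: the products of at most
   n elements of S and their inverses. *)
Definition word_ball (G : groupType) (S : set G) (n : nat) : set G :=
  [set g | exists s : seq G,
     [/\ (size s <= n)%N,
         forall x, x \in s -> S x \/ S (x^-1)%g
       & g = (\prod_(x <- s) x)%g]].

Definition finite_generating_set (G : groupType) (S : set G) : Prop :=
  finite_set S /\ forall g : G, exists n, word_ball S n g.

Definition finitely_generated (G : groupType) : Prop :=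
  exists S : set G, finite_generating_set S.

Definition residually_finite (G : groupType) : Prop :=
  forall g : G, g <> 1%g ->
    exists (F : finGroupType) (pi : {multiplicative G -> F}), pi g <> 1%g.

(* Minimum of a nonempty set of naturals; the value 0 on the empty set is
   a dummy (both sets below are nonempty for finite S and residually finite
   G). *)
Definition nat_min (A : set nat) : nat :=
  xget 0%N [set m | A m /\ forall k, A k -> (m <= k)%N].

Definition full_rf_growth (G : groupType) (S : set G) (n : nat) : nat :=
  nat_min [set m | exists (F : finGroupType) (pi : {multiplicative G -> F}),
    #|F| = m /\ set_inj (word_ball S n) pi].

Record is_metric (R : realType) (T : Type) (d : T -> T -> R) : Prop := {
  metric_ge0 : forall x y, 0 <= d x y ;
  metric_eq0 : forall x y, d x y = 0 <-> x = y ;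
  metric_sym : forall x y, d x y = d y x ;
  metric_triangle : forall x y z, d x z <= d x y + d y z }.

Definition bi_invariant (R : realType) (G : groupType) (d : G -> G -> R) :
    Prop :=
  forall x y z : G, d (z * x)%g (z * y)%g = d x y /\
                    d (x * z)%g (y * z)%g = d x y.

(* The map pi is only required to be defined on the ball; here it is a total
   function whose values outside the ball are unconstrained. *)
Definition weakly_sofic_approx (R : realType) (G : groupType) (S : set G)
    (n : nat) (H : finGroupType) (d : H -> H -> R) (pi : G -> H) : Prop :=
  (forall g h : G, word_ball S n g -> word_ball S n h ->
     word_ball S n (g * h)%g ->
     d (pi g * pi h)%g (pi (g * h)%g) <= n%:R^-1) /\
  (forall g h : G, word_ball S n g -> word_ball S n h -> g <> h ->
     1 - n%:R^-1 <= d (pi g) (pi h)).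

Definition weakly_sofic_profile (R : realType) (G : groupType) (S : set G)
    (n : nat) : nat :=
  nat_min [set m | exists (H : finGroupType) (d : H -> H -> R) (pi : G -> H),
    [/\ #|H| = m,
        is_metric d,
        forall x y, d x y <= 1,
        bi_invariant d
      & weakly_sofic_approx S n d pi]].

(* Functions on {1, 2, ...} are functions on nat whose value at 0 is ignored;
   the ceiling below is positive, so the absolute value is only a cast from
   int to nat. *)
Definition growth_le (R : realType) (f1 f2 : nat -> nat) : Prop :=
  exists C : R, 0 < C /\
    forall n : nat, (0 < n)%N ->
      (f1 n <= f2 `|Num.ceil (C * n%:R)|%N)%N.

Definition growth_equiv (R : realType) (f1 f2 : nat -> nat) : Prop :=
  growth_le R f1 f2 /\ growth_le R f2 f1.

(* Main.v *)
(* Idea. Let G be the subgroup of the product of the groups Sym(Z/m_j) that is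
   generated by the diagonal elements a = (the transpositions (0 1)) and
   t = (the cycles x -> x + 1), where m_j divides m_(j+1) and m_(j+1) is huge
   compared with m_j.

   Words of length at most l satisfy the same equalities in Sym(Z/M) for all
   M >= 4 l + 8, because they can be read off from the action of the word on Z.
   Hence, as long as n is far below m_(k+1), the n-ball of G is modelled
   faithfully in the product of the Sym(Z/m_j), j <= k, and Sym(Z/M) with M
   linear in n; with the 0-1 metric this bounds the weakly sofic profile by a
   function of k, m_k and n only.

   On the other hand let z_i = [a, a^(t^i)], let X = m_k, and let r be the order
   of the image of t in a finite quotient F of G.  If r X is below m_(k+1), then
   z_(1+rX) = z_(1+X+rX) already in G: in coordinates j <= k because z_i only
   depends on i mod m_j, and in the others because z_i = 1 for 1 < i < m_j - 1.
   So z_1 and z_(1+X) agree in F, while they differ in coordinate k+1 of G.  A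
   quotient that is injective on a ball of radius linear in m_k thus has order
   at least about m_(k+1) / m_k. *)
Require Import Defs.
From HB Require Import structures.
From mathcomp Require Import all_boot all_order all_algebra all_fingroup.
From mathcomp Require Import boolp classical_sets functions cardinality reals.
From mathcomp Require Import zify.

Set Implicit Arguments.
Unset Strict Implicit.
Unset Printing Implicit Defensive.

Import Order.TTheory GRing.Theory Num.Theory.

Local Open Scope group_scope.

(** * Words in two letters *)

(* (is it t rather than a?, exponent 1 rather than -1?) *)
Definition letter : Type := bool * bool.

Definition letter_val (G : groupType) (a t : G) (l : letter) : G :=
  let x := if l.1 then t else a in if l.2 then x else x^-1.

Definition word_val (G : groupType) (a t : G) (w : seq letter) : G :=
  \prod_(l <- w) letter_val a t l.

Definition letter_inv (l : letter) : letter := (l.1, ~~ l.2).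

Definition word_inv (w : seq letter) : seq letter := rev (map letter_inv w).

(* This is the commutator [a, a ^ (t ^+ i)] when a is an involution. *)
Definition shift_comm (G : groupType) (a t : G) (i : nat) : G :=
  a * a ^ (t ^+ i) * (a * a ^ (t ^+ i)).

Definition shift_comm_word (i : nat) : seq letter :=
  let b := nseq i (true, false) ++ (false, true) :: nseq i (true, true) in
  ((false, true) :: b) ++ ((false, true) :: b).

Section Words.
Variables (G : groupType) (a t : G).

Lemma word_val_cat u v :
  word_val a t (u ++ v) = word_val a t u * word_val a t v.
Proof. by rewrite /word_val big_cat. Qed.

Lemma word_val_cons l w :
  word_val a t (l :: w) = letter_val a t l * word_val a t w.
Proof. by rewrite /word_val big_cons. Qed.

Lemma word_val_nil : word_val a t [::] = 1.
Proof. by rewrite /word_val big_nil. Qed.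

Lemma word_val_inv w : word_val a t (word_inv w) = (word_val a t w)^-1.
Proof.
elim: w => [|l w IH]; first by rewrite word_val_nil invg1.
rewrite /word_inv /= rev_cons -cats1 word_val_cat IH !word_val_cons word_val_nil.
rewrite mulg1 invgM; congr (_ * _).
by case: l => [[] []]; rewrite /letter_val /= ?invgK.
Qed.

Lemma word_val_nseq l n : word_val a t (nseq n l) = letter_val a t l ^+ n.
Proof.
elim: n => [|n IH]; first by rewrite word_val_nil.
by rewrite /= word_val_cons IH expgS.
Qed.

Lemma shift_comm_wordE i : word_val a t (shift_comm_word i) = shift_comm a t i.
Proof.
rewrite /shift_comm_word word_val_cat word_val_cons word_val_cat word_val_cons.
by rewrite !word_val_nseq /= /shift_comm /conjg expVgn.
Qed.

End Words.

Lemma size_word_inv w : size (word_inv w) = size w.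
Proof. by rewrite size_rev size_map. Qed.

Lemma size_shift_comm_word i : size (shift_comm_word i) = (4 * i + 4)%N.
Proof.
rewrite /shift_comm_word /= !(size_cat, size_nseq) /= !(size_cat, size_nseq) /=.
by rewrite !size_nseq; lia.
Qed.

Lemma morph_word_val (G K : groupType) (f : G -> K) a t w :
  {morph f : x y / x * y} -> f (word_val a t w) = word_val (f a) (f t) w.
Proof.
move=> fM; have f1 : f 1 = 1.
  by apply: (mulgI (f 1)); rewrite -fM !mulg1.
have fV x : f x^-1 = (f x)^-1.
  by apply: (mulgI (f x)); rewrite -fM !mulgV.
elim: w => [|l w IH]; first by rewrite !word_val_nil.
rewrite !word_val_cons fM IH; congr (_ * _).
by case: l => [[] []]; rewrite /letter_val /= ?fV.
Qed.

(** * The transposition and the cycle in Sym(Z/M) *)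

Section Cycle.
Variable M : nat.

Definition cycle_perm : {perm 'Z_M} := perm (@addrI 'Z_M 1%R).
Definition swap_perm : {perm 'Z_M} := tperm 0%R 1%R.

Local Notation val := (word_val swap_perm cycle_perm).

Lemma cycle_permE x : cycle_perm x = (1 + x)%R.
Proof. by rewrite permE. Qed.

Lemma cycle_permVE x : cycle_perm^-1 x = (x - 1)%R.
Proof.
by apply: (perm_inj (s := cycle_perm)); rewrite permKV cycle_permE addrC subrK.
Qed.

Lemma cycle_permX i x : (cycle_perm ^+ i) x = (i%:R + x)%R.
Proof.
elim: i x => [|i IH] x; first by rewrite expg0 perm1 add0r.
by rewrite expgS permM IH cycle_permE addrA natr1.
Qed.

Lemma swap_permX2 : swap_perm * swap_perm = 1.
Proof. exact: tperm2. Qed.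

Hypothesis M_gt1 : (1 < M)%N.

Lemma natr_Zp_eq0 n : ((n%:R : 'Z_M) == 0)%R = (M %| n)%N.
Proof. by rewrite -val_eqE /= val_Zp_nat. Qed.

Lemma intr_Zp_eq0 (x : int) : ((x%:~R : 'Z_M) == 0)%R = (M%:Z %| x)%Z.
Proof.
rewrite dvdzE /=; case: (intP x) => [|n|n] //=.
- by rewrite dvdn0 eqxx.
- by rewrite natr_Zp_eq0.
- by rewrite mulrNz oppr_eq0 natr_Zp_eq0.
Qed.

Lemma intr_Zp_eq (x y : int) : (`|x - y| < M)%N ->
  ((x%:~R : 'Z_M) == y%:~R)%R = (x == y).
Proof.
move=> lt; rewrite -subr_eq0 -intrB intr_Zp_eq0 dvdzE /=.
apply/idP/eqP => [|->]; last by rewrite subrr.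
by have [|/dvdn_leq h /h] := posnP `|x - y|%N; lia.
Qed.

Lemma cycle_permX_eq1 i : (M %| i)%N -> cycle_perm ^+ i = 1.
Proof.
rewrite -natr_Zp_eq0 => /eqP i0.
by apply/permP => x; rewrite cycle_permX i0 add0r perm1.
Qed.

Lemma swap_permJ i :
  swap_perm ^ (cycle_perm ^+ i) = tperm (i%:R)%R (i.+1%:R)%R.
Proof. by rewrite tpermJ !cycle_permX addr0 natr1. Qed.

(** The transpositions (0 1) and (i i+1) are disjoint in this range, hence commute. The bound
    [i + 2 <= M] keeps i+1 from wrapping around to 0. *)
Lemma shift_comm_cycle_eq1 i : (1 < i)%N -> (i + 2 <= M)%N ->
  shift_comm swap_perm cycle_perm i = 1.
Proof.
move=> i1 iM; rewrite /shift_comm swap_permJ.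
have fixed n : (1 < n)%N -> (n < M)%N -> swap_perm (n%:R)%R = (n%:R)%R.
  move=> n1 nM; apply: tpermD; rewrite eq_sym -[(n%:R)%R]/(n%:Z%:~R)%R.
    by rewrite -[X in _ != X]/(0%:Z%:~R)%R intr_Zp_eq; lia.
  by rewrite -[X in _ != X]/(1%:Z%:~R)%R intr_Zp_eq; lia.
set b := tperm _ _; have bJ : b ^ swap_perm = b by rewrite tpermJ !fixed //; lia.
by rewrite -{2}bJ -conjgC -mulgA (mulgA b) tperm2 mul1g swap_permX2.
Qed.

(** The product of (0 1) and (1 2) is a 3-cycle, so its square is not 1; concretely the square sends
    0 to 1. *)
Lemma shift_comm_cycle1_neq1 : (2 < M)%N -> shift_comm swap_perm cycle_perm 1 <> 1.
Proof.
move=> M2 /permP /(_ (0%:Z%:~R)%R).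
have lt01 : (0%:Z%:~R : 'Z_M)%R != (1%:Z%:~R)%R by rewrite intr_Zp_eq.
have lt02 : (0%:Z%:~R : 'Z_M)%R != (2%:Z%:~R)%R by rewrite intr_Zp_eq.
have lt12 : (1%:Z%:~R : 'Z_M)%R != (2%:Z%:~R)%R by rewrite intr_Zp_eq.
rewrite /shift_comm swap_permJ !permM perm1 /swap_perm.
rewrite -[0%R]/(0%:Z%:~R)%R -[1%R]/(1%:Z%:~R)%R -[(1%:R)%R]/(1%:Z%:~R)%R.
rewrite -[(2%:R)%R]/(2%:Z%:~R)%R.
rewrite tpermL tpermL (tpermD lt02 lt12) tpermR => /eqP.
by rewrite eq_sym (negPf lt01).
Qed.

(** Centred representatives leave a margin of about M/2 before a walk wraps around, so
    [word_val_intr] reaches every residue. *)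
Lemma Zp_intr_repr (y : 'Z_M) : exists2 x : int, y = (x%:~R)%R & (2 * `|x| <= M)%N.
Proof.
have yM : (y < M)%N by have := ltn_ord y; rewrite [X in (_ < X)%N -> _]Zp_cast.
have yE : y = ((Posz y)%:~R)%R by rewrite -[LHS]natr_Zp.
case: (leqP (2 * y) M) => h; first by exists (Posz y).
exists (Posz y - Posz M)%R; last by lia.
rewrite intrB -yE; suff -> : (M%:Z%:~R : 'Z_M)%R = 0%R by rewrite subr0.
by apply/eqP; rewrite intr_Zp_eq0 dvdzz.
Qed.

End Cycle.

(** * The action of words on the integers *)

Definition letter_step (l : letter) (x : int) : int :=
  (if l.1 then if l.2 then 1 + x else x - 1
  else if x == 0 then 1 else if x == 1 then 0 else x)%R.

Definition walk (w : seq letter) (x : int) : int :=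
  foldl (fun x l => letter_step l x) x w.

Definition drift (w : seq letter) : int :=
  foldr (fun l z => ((if l.1 then if l.2 then 1 else -1 else 0) + z)%R) 0%R w.

Lemma letter_step_dist l x : (`|letter_step l x - x| <= 1)%N.
Proof. by case: l => [[] []]; rewrite /letter_step /=; do ?case: eqP; lia. Qed.

Lemma walk_dist w x : (`|walk w x - x| <= size w)%N.
Proof.
elim: w x => [|l w IH] x /=; first by lia.
have := IH (letter_step l x); have := letter_step_dist l x; rewrite /walk /=; lia.
Qed.

(** Each letter moves a point by at most 1, so a walk starting this far out never reaches 0 or 1 and
    the swaps act trivially. *)
Lemma walk_far w x : (size w + 1 < `|x|)%N -> walk w x = (x + drift w)%R.
Proof.
elim: w x => [|l w IH] x /=; first by rewrite addr0.
move=> h; rewrite /walk /= -/(walk _ _) IH; last by have := letter_step_dist l x; lia.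
by case: l h => [[] []]; rewrite /letter_step /=; do ?case: eqP; lia.
Qed.

(** The size condition ensures that a point met by the walk is 0 or 1 modulo M only if it is 0 or 1
    in Z. *)
Lemma word_val_intr M w x : (1 < M)%N -> (`|x| + size w + 1 < M)%N ->
  word_val (swap_perm M) (cycle_perm M) w (x%:~R)%R = ((walk w x)%:~R)%R.
Proof.
move=> M1; elim: w x => [|l w IH] x /= h; first by rewrite word_val_nil perm1.
rewrite word_val_cons permM.
have -> : letter_val (swap_perm M) (cycle_perm M) l (x%:~R)%R = ((letter_step l x)%:~R)%R.
  have swapE : swap_perm M (x%:~R)%R = ((letter_step (false, true) x)%:~R)%R.
    rewrite /letter_step /=; have [->|x0] := eqVneq x 0%R; first by rewrite tpermL.
    have [->|x1] := eqVneq x 1%R; first by rewrite tpermR.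
    apply: tpermD.
    - by rewrite -[X in X != _]/(0%:Z%:~R)%R intr_Zp_eq; lia.
    - by rewrite -[X in X != _]/(1%:Z%:~R)%R intr_Zp_eq; lia.
  case: l {h} => [[] []] //=; rewrite /letter_val /=.
  - by rewrite cycle_permE intrD.
  - by rewrite cycle_permVE intrB.
  - by rewrite tpermV.
by rewrite IH //; have := letter_step_dist l x; lia.
Qed.

(* Near 0 the walk on Z is determined modulo M; far from 0 it never meets the
   transposed points and is a translation by the drift. *)
Lemma word_val_walk M n u v : (size u <= n)%N -> (size v <= n)%N -> (4 * n + 8 <= M)%N ->
  word_val (swap_perm M) (cycle_perm M) u = word_val (swap_perm M) (cycle_perm M) v
  <-> walk u =1 walk v.
Proof.
move=> un vn nM; have M1 : (1 < M)%N by lia.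
split=> [uv|uv]; last first.
  apply/permP => y; have [x -> xM] := Zp_intr_repr M1 y.
  by rewrite !word_val_intr ?uv //; lia.
have near x : (`|x| <= n + 2)%N -> walk u x = walk v x.
  move=> xn; apply/eqP; rewrite -(intr_Zp_eq M1); last first.
    by have := walk_dist u x; have := walk_dist v x; lia.
  by rewrite -!word_val_intr ?uv //; lia.
(* The point n + 2 is in the near range and already far enough for [walk_far], so it reveals the
   drift. *)
have duv : drift u = drift v.
  apply: (addrI (Posz (n + 2))); rewrite -!walk_far; [exact: near|lia|lia].
move=> x; case: (leqP `|x| (n + 2)) => [|h]; first exact: near.
by rewrite !walk_far ?duv //; lia.
Qed.

Lemma word_val_stable M M' n u v :
  (size u <= n)%N -> (size v <= n)%N -> (4 * n + 8 <= M)%N -> (4 * n + 8 <= M')%N ->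
  word_val (swap_perm M) (cycle_perm M) u = word_val (swap_perm M) (cycle_perm M) v ->
  word_val (swap_perm M') (cycle_perm M') u = word_val (swap_perm M') (cycle_perm M') v.
Proof. by move=> un vn nM nM' /(word_val_walk un vn nM) /(word_val_walk un vn nM'). Qed.

(** * Two-generated subgroups and infinite products *)

Section TwoGenerated.
Variables (G : groupType) (a t : G).

Definition generated_by2 : {pred G} := fun g => `[< exists w, g = word_val a t w >].

Lemma generated_by2_closed : group_closed generated_by2.
Proof.
split; first by apply/asboolP; exists [::]; rewrite word_val_nil.
move=> x y /asboolP[u ->] /asboolP[v ->]; apply/asboolP.
by exists (u ++ word_inv v); rewrite word_val_cat word_val_inv.
Qed.

Definition two_generated := {g : G | generated_by2 g}.

HB.instance Definition _ := SubChoice.on two_generated.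
HB.instance Definition _ :=
  SubChoice_isSubGroup.Build G generated_by2 two_generated generated_by2_closed.

Lemma generated_by2_l : generated_by2 a.
Proof. by apply/asboolP; exists [:: (false, true)];
  rewrite word_val_cons word_val_nil mulg1. Qed.

Lemma generated_by2_r : generated_by2 t.
Proof. by apply/asboolP; exists [:: (true, true)];
  rewrite word_val_cons word_val_nil mulg1. Qed.

Definition gen_l : two_generated := Sub a generated_by2_l.
Definition gen_r : two_generated := Sub t generated_by2_r.

Lemma val_word_val w : val (word_val gen_l gen_r w) = word_val a t w.
Proof. by rewrite (morph_word_val (f := val)). Qed.

Lemma two_generatedP (g : two_generated) : exists w, g = word_val gen_l gen_r w.
Proof.
case: (g) => x; move=> xP; have /asboolP[w xw] := xP; exists w.
by apply: val_inj; rewrite val_word_val.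
Qed.

End TwoGenerated.

Section Product.
Variables (I : Type) (G : I -> groupType).

Definition product_group : Type := forall i, G i.

HB.instance Definition _ := gen_eqMixin product_group.
HB.instance Definition _ := gen_choiceMixin product_group.

Let one : product_group := fun=> 1.
Let inv (x : product_group) : product_group := fun i => (x i)^-1.
Let mul (x y : product_group) : product_group := fun i => x i * y i.

Let mulA : associative mul.
Proof. by move=> x y z; apply: functional_extensionality_dep => i; apply: mulgA. Qed.
Let mul1 : left_id one mul.
Proof. by move=> x; apply: functional_extensionality_dep => i; apply: mul1g. Qed.
Let mulr1 : right_id one mul.
Proof. by move=> x; apply: functional_extensionality_dep => i; apply: mulg1. Qed.
Let mulV : left_inverse one inv mul.
Proof. by move=> x; apply: functional_extensionality_dep => i; apply: mulVg. Qed.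
Let mulrV : right_inverse one inv mul.
Proof. by move=> x; apply: functional_extensionality_dep => i; apply: mulgV. Qed.

HB.instance Definition _ := isGroup.Build product_group mulA mul1 mulr1 mulV mulrV.

End Product.

(** * Balls of an arbitrary generating set versus words in a and t *)

Section WordBalls.
Variables (G : groupType) (a t : G).
Hypothesis word_surj : forall g : G, exists w, g = word_val a t w.

(** Spelling each element of [S] as a fixed word costs a constant factor in length. With the
    converse [words_word_ball], this lets all estimates be made on words and then hold for every
    [S]. *)
Lemma word_ball_words (S : set G) : finite_set S ->
  exists c : nat, forall n g, word_ball S n g ->
    exists2 w, (size w <= c * n)%N & g = word_val a t w.
Proof.
move=> finS.
have [c cP] : exists c : nat, forall g, S g -> exists2 w, (size w <= c)%N & g = word_val a t w.
  have [s ->] := (finite_seqP S).1 finS.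
  elim: s => [|x s [c IH]]; first by exists 0%N.
  have [w xw] := word_surj x.
  exists (maxn c (size w)) => g /=; rewrite inE => /orP[/eqP ->|/IH[v vc ->]].
    by exists w; rewrite ?leq_maxr.
  by exists v; rewrite // (leq_trans vc) ?leq_maxl.
have cP' g : S g \/ S g^-1 -> exists2 w, (size w <= c)%N & g = word_val a t w.
  case=> [/cP //|/cP[w wc gw]]; exists (word_inv w); first by rewrite size_word_inv.
  by rewrite word_val_inv -gw invgK.
exists c => n g [s [sn sS ->]].
suff [w wc ->] : exists2 w, (size w <= c * size s)%N & \prod_(x <- s) x = word_val a t w.
  by exists w => //; rewrite (leq_trans wc) // leq_mul2l sn orbT.
elim: s {sn} sS => [|x s IH] sS; first by exists [::]; rewrite ?big_nil ?word_val_nil.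
have [|w wc sw] := IH; first by move=> y ys; apply: sS; rewrite inE ys orbT.
have [|v vc xv] := cP' x; first by apply: sS; rewrite inE eqxx.
exists (v ++ w); first by rewrite size_cat mulnS leq_add.
by rewrite big_cons word_val_cat -xv sw.
Qed.

Lemma word_ball_leq (S : set G) m n g : (m <= n)%N -> word_ball S m g -> word_ball S n g.
Proof. by move=> mn [s [sm sS gs]]; exists s; split=> //; apply: leq_trans mn. Qed.

Lemma word_ball_mul (S : set G) m n g h :
  word_ball S m g -> word_ball S n h -> word_ball S (m + n) (g * h).
Proof.
move=> [u [um uS ->]] [v [vn vS ->]]; exists (u ++ v); split.
- by rewrite size_cat leq_add.
- by move=> x; rewrite mem_cat => /orP[/uS|/vS].
- by rewrite big_cat.
Qed.

Lemma words_word_ball (S : set G) : finite_generating_set S ->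
  exists c : nat, forall w, word_ball S (c * size w) (word_val a t w).
Proof.
move=> [_ genS].
have [c1 h1] := genS a; have [c2 h2] := genS t.
have [c3 h3] := genS a^-1; have [c4 h4] := genS t^-1.
exists (c1 + c2 + c3 + c4)%N; elim=> [|l w IH].
  by exists [::]; rewrite word_val_nil big_nil.
rewrite word_val_cons /= mulnS; apply: word_ball_mul => //.
case: l => [[] []]; rewrite /letter_val /=.
- by apply: word_ball_leq h2; lia.
- by apply: word_ball_leq h4; lia.
- by apply: word_ball_leq h1; lia.
- by apply: word_ball_leq h3; lia.
Qed.

End WordBalls.

(** * Bounding the profile by the 0-1 metric *)

Lemma nat_min_spec (A : set nat) m : A m ->
  A (nat_min A) /\ forall k, A k -> (nat_min A <= k)%N.
Proof.
move=> Am; rewrite /nat_min; case: xgetP => [x _ //|no].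
have exA : exists n, `[< A n >] by exists m; apply/asboolP.
have [n /asboolP An min] := find_ex_minn exA.
by case: (no n); split=> // k Ak; apply: min; apply/asboolP.
Qed.

Section DiscreteMetric.
Variables (R : realType) (H : finGroupType).
Local Open Scope ring_scope.

Definition discrete_dist (x y : H) : R := (x != y)%:R.

Lemma discrete_dist_metric : is_metric discrete_dist.
Proof.
rewrite /discrete_dist; split=> [x y|x y|x y|x y z].
- exact: ler0n.
- split=> [/eqP|->]; last by rewrite eqxx.
  by rewrite pnatr_eq0 eqb0 negbK => /eqP.
- by rewrite eq_sym.
- rewrite -natrD ler_nat; have [->|] := eqVneq x y; first by [].
  by case: (x == z).
Qed.

Lemma discrete_dist_bi_invariant : bi_invariant discrete_dist.
Proof. by move=> x y z; rewrite /discrete_dist (inj_eq (mulgI z)) (inj_eq (mulIg z)). Qed.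

End DiscreteMetric.

(** Under the 0-1 metric, exact products have defect 0 and distinct images have distance 1, which
    meets the tolerance for every n. *)
Lemma weakly_sofic_profile_le (R : realType) (G : groupType) (S : set G) n
    (H : finGroupType) (pi : G -> H) :
  (forall g h, word_ball S n g -> word_ball S n h -> word_ball S n (g * h) ->
     pi g * pi h = pi (g * h)) ->
  set_inj (word_ball S n) pi ->
  (weakly_sofic_profile R S n <= #|H|)%N.
Proof.
move=> piM pi_inj; rewrite /weakly_sofic_profile; set A := (X in nat_min X).
have AH : A #|H|; last by have [_] := nat_min_spec AH; apply.
exists H, (@discrete_dist R H), pi; split=> //.
- exact: discrete_dist_metric.
- by move=> x y; rewrite lern1 leq_b1.
- exact: discrete_dist_bi_invariant.
split=> [g h Bg Bh Bgh|g h Bg Bh gh]; rewrite /discrete_dist.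
  by rewrite piM // eqxx invr_ge0 ler0n.
have -> : pi g != pi h by apply/eqP => /pi_inj e; apply: gh; apply: e; rewrite inE.
by rewrite lerBlDr lerDl invr_ge0 ler0n.
Qed.

(** * Finite products of symmetric groups *)

Section FiniteModel.
Variables (n : nat) (mm : 'I_n -> nat).

Definition perm_model : finGroupType := {dffun forall j : 'I_n, {perm 'Z_(mm j)}}.

Definition model_swap : perm_model := [ffun j => swap_perm (mm j)].
Definition model_cycle : perm_model := [ffun j => cycle_perm (mm j)].

Lemma model_word_val w j : (word_val model_swap model_cycle w : {dffun _}) j =
  word_val (swap_perm (mm j)) (cycle_perm (mm j)) w.
Proof.
rewrite (morph_word_val (f := fun x : perm_model => (x : {dffun _}) j)).
  by rewrite !ffunE.
by move=> x y /=; rewrite ffunE.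
Qed.

Lemma model_word_val_eq u v :
  word_val model_swap model_cycle u = word_val model_swap model_cycle v <->
  forall j, word_val (swap_perm (mm j)) (cycle_perm (mm j)) u =
            word_val (swap_perm (mm j)) (cycle_perm (mm j)) v.
Proof.
split=> [uv j|uv]; first by rewrite -!model_word_val uv.
apply/ffunP => j; rewrite !model_word_val. exact: uv.
Qed.

Lemma card_perm_model M : (1 < M)%N -> (forall j, (1 < mm j <= M)%N) ->
  (#|perm_model| <= M`! ^ n)%N.
Proof.
move=> M1 mmM; rewrite card_dep_ffun -[X in (_ <= _ ^ X)%N]card_ord cardE /image_mem.
elim: (enum _) => [|j s IH] //=; rewrite expnS leq_mul //.
rewrite card_Sn Zp_cast; last by have /andP[] := mmM j.
by apply: leq_fact; have /andP[] := mmM j.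
Qed.

End FiniteModel.

(** * The periods m_j, the group G and its finite models *)

(* Fed with the radius n = k (4 x + 8), which covers z_1 and z_(1+x), this is
   8 k (k n) + 8: one factor k absorbs the comparison constant C, the other the
   change of generating set. *)
Definition model_degree (k x : nat) : nat := 8 * (k * (k * (k * (4 * x + 8)))) + 8.

(** The power of the factorial bounds the order of the level-k model. The summand 5 absorbs the
    lower-order terms of [period_le_quotient], and starting at 4 makes z_1 nontrivial in every
    coordinate. *)
Fixpoint period (k : nat) : nat :=
  if k is k'.+1 then period k' * ((model_degree k' (period k'))`! ^ k'.+2 + 5) else 4.

Lemma dvdn_period i j : (i <= j)%N -> (period i %| period j)%N.
Proof.
elim: j => [|j IH]; first by rewrite leqn0 => /eqP ->.
by rewrite leq_eqVlt => /orP[/eqP -> //|/IH]; apply: dvdn_mulr.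
Qed.

Lemma period_ge k : (k + 4 <= period k)%N.
Proof. by elim: k => [|k IH] //=; nia. Qed.

Lemma period_leq i j : (i <= j)%N -> (period i <= period j)%N.
Proof. by move=> /dvdn_period /dvdn_leq; apply; have := period_ge j; lia. Qed.

Lemma period_gt1 k : (1 < period k)%N.
Proof. by have := period_ge k; lia. Qed.

Definition sym_product : groupType :=
  product_group (fun j : nat => {perm 'Z_(period j)} : groupType).
Definition swaps : sym_product := fun j => swap_perm (period j).
Definition cycles : sym_product := fun j => cycle_perm (period j).
Definition diag_group : groupType := two_generated swaps cycles.

Local Notation word w := (word_val (gen_l swaps cycles) (gen_r swaps cycles) w).

Definition coord (j : nat) (g : diag_group) : {perm 'Z_(period j)} := (\val g : sym_product) j.

Lemma coordM j : {morph coord j : x y / x * y}.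
Proof. by []. Qed.

HB.instance Definition _ j :=
  isMultiplicative.Build diag_group {perm 'Z_(period j)} (coord j) (coordM j).

Lemma coord_word j w :
  coord j (word w) = word_val (swap_perm (period j)) (cycle_perm (period j)) w.
Proof. exact: (morph_word_val _ _ _ (coordM j)). Qed.

Lemma coord_eq (g h : diag_group) : (forall j, coord j g = coord j h) -> g = h.
Proof. by move=> gh; apply/val_inj/functional_extensionality_dep. Qed.

Lemma finitely_generated_diag : finitely_generated diag_group.
Proof.
exists [set gen_l swaps cycles; gen_r swaps cycles]%classic; split.
  exact: finite_set2.
move=> g; have [w ->] := two_generatedP g.
exists (size w), (map (letter_val (gen_l swaps cycles) (gen_r swaps cycles)) w).
split; first by rewrite size_map.
  move=> x /mapP[[[] []] _ ->]; rewrite /letter_val /= ?invgK; tauto.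
by rewrite big_map.
Qed.

Lemma residually_finite_diag : residually_finite diag_group.
Proof.
move=> g g1; apply: contrapT => no; apply: g1; apply: coord_eq => j.
apply: contrapT => gj; apply: no.
by exists ({perm 'Z_(period j)} : finGroupType), (coord j).
Qed.

(** All coordinates beyond k have period at least [period k.+1], so by [word_val_stable] they
    satisfy the same short equalities as the single degree M. *)
Lemma word_eq_trunc (n k M : nat) u v :
  (size u <= n)%N -> (size v <= n)%N -> (4 * n + 8 <= M)%N ->
  (4 * n + 8 <= period k.+1)%N ->
  word u = word v <->
  forall j : 'I_k.+2, let m := if (j <= k)%N then period j else M in
    word_val (swap_perm m) (cycle_perm m) u = word_val (swap_perm m) (cycle_perm m) v.
Proof.
move=> un vn nM nk; split=> [uv j|uv].
  case: leqP => jk /=; first by rewrite -!coord_word uv.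
  by apply: (word_val_stable un vn nk nM); rewrite -!coord_word uv.
apply: coord_eq => j; rewrite !coord_word; case: (leqP j k) => jk.
  have jk2 : (j < k.+2)%N by lia.
  by have /= := uv (Ordinal jk2); rewrite jk.
have := uv ord_max; rewrite /= ltnn.
by apply: (word_val_stable un vn nM); have := period_leq jk; lia.
Qed.

(** Projection to the first coordinates is a homomorphism, injective on the ball once enough of them
    are kept; so the minimum is over a nonempty set. *)
Lemma full_rf_growth_attained (S : set diag_group) n : finite_set S ->
  exists (F : finGroupType) (pi : {multiplicative diag_group -> F}),
    #|F| = full_rf_growth S n /\ set_inj (word_ball S n) pi.
Proof.
move=> finS; have [c cP] := word_ball_words (@two_generatedP _ swaps cycles) finS.
(* Periods exceed their index, so this k makes [period k.+1] large enough to serve as M; the model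
   is then a true quotient. *)
pose k := (4 * (c * n) + 8)%N; pose mm (j : 'I_k.+2) := period j.
pose pi (g : diag_group) : perm_model mm := [ffun j : 'I_k.+2 => coord j g].
have piM : {morph pi : x y / x * y}.
  by move=> x y; apply/ffunP => j; rewrite !ffunE coordM.
pose pi' := HB.pack_for {multiplicative diag_group -> perm_model mm} pi
  (isMultiplicative.Build diag_group (perm_model mm) pi piM).
have inj : set_inj (word_ball S n) pi'.
  move=> g h; rewrite !inE => /cP[u un ->] /cP[v vn ->] /ffunP e.
  have kP := period_ge k.+1.
  apply/(word_eq_trunc un vn (M := period k.+1) (k := k)); [lia|lia|].
  move=> j /=; have -> : (if (j <= k)%N then period j else period k.+1) = period j.
    by case: leqP => // jk; congr period; have := ltn_ord j; lia.
  by have := e j; rewrite !ffunE !coord_word.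
rewrite /full_rf_growth; set A := (X in nat_min X).
have AH : A #|perm_model mm| by exists (perm_model mm), pi'.
by have [[F [f [Ff finj]]] _] := nat_min_spec AH; exists F, f.
Qed.

Lemma profile_le_rf_growth (R : realType) (S : set diag_group) n : finite_set S ->
  (weakly_sofic_profile R S n <= full_rf_growth S n)%N.
Proof.
move=> finS; have [F [pi [<- pi_inj]]] := full_rf_growth_attained n finS.
by apply: (@weakly_sofic_profile_le _ _ _ _ _ pi) => // g h _ _ _; rewrite gmulfM.
Qed.

(** M need not be a period, so the map is built from chosen words and is multiplicative only
    locally: it compares rep g rep h, of length up to 2L, with rep (gh). Hence the bound 8L + 8 = 4
    (2L) + 8. *)
Lemma profile_le_model (R : realType) (S : set diag_group) n L k M :
  (forall g, word_ball S n g -> exists2 w, (size w <= L)%N & g = word w) ->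
  (8 * L + 8 <= M)%N -> (period k <= M <= period k.+1)%N ->
  (weakly_sofic_profile R S n <= M`! ^ k.+2)%N.
Proof.
move=> BL LM /andP[kM Mk].
pose mm (j : 'I_k.+2) := if (j <= k)%N then period j else M.
have M1 : (1 < M)%N by lia.
have mmM j : (1 < mm j <= M)%N.
  rewrite /mm; case: (leqP j k) => jk; last by rewrite M1 /=.
  by rewrite period_gt1 (leq_trans (period_leq jk)).
(* The implication sits under the existential so that [choice] yields a total function. *)
have short g : exists w, word_ball S n g -> (size w <= L)%N /\ g = word w.
  case: (pselect (word_ball S n g)) => [/BL[w wL gw]|no]; first by exists w.
  by exists [::].
have [rep repP] := choice short.
have transfer u v : (size u <= 2 * L)%N -> (size v <= 2 * L)%N ->
  word u = word v <->
  word_val (model_swap mm) (model_cycle mm) u = word_val (model_swap mm) (model_cycle mm) v.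
  move=> uL vL; rewrite model_word_val_eq.
  by apply: (word_eq_trunc (n := 2 * L)) => //; lia.
apply: leq_trans (card_perm_model M1 mmM).
pose pi g := word_val (model_swap mm) (model_cycle mm) (rep g).
apply: (@weakly_sofic_profile_le _ _ _ _ _ pi); rewrite /pi.
  move=> g h /repP[gL gw] /repP[hL hw] /repP[ghL ghw].
  rewrite -word_val_cat; apply/transfer; first by rewrite size_cat; lia.
    by lia.
  by rewrite word_val_cat -gw -hw -ghw.
move=> g h; rewrite !inE => /repP[gL gw] /repP[hL hw] /transfer e.
by rewrite gw hw; apply: e; lia.
Qed.

(** * Lower bound for finite quotients *)

Lemma coord_shift_comm j i :
  coord j (shift_comm (gen_l swaps cycles) (gen_r swaps cycles) i) =
  shift_comm (swap_perm (period j)) (cycle_perm (period j)) i.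
Proof. by rewrite -!shift_comm_wordE coord_word. Qed.

(** The length 4X + 8 is that of the word for z_(1+X). The largest index used, 1 + X + rX with r at
    most |F|, must stay 2 below [period k.+1]; this gives (|F| + 1) X + 3. *)
Lemma period_le_quotient (S : set diag_group) n k (F : finGroupType)
    (pi : {multiplicative diag_group -> F}) :
  (forall w, (size w <= 4 * period k + 8)%N -> word_ball S n (word w)) ->
  set_inj (word_ball S n) pi ->
  (period k.+1 < (#|F| + 1) * period k + 3)%N.
Proof.
move=> BS pi_inj; rewrite ltnNge; apply/negP => big.
set X := period k in BS big *.
have X4 : (4 <= X)%N by have := period_ge k; rewrite -/X; lia.
set a := gen_l swaps cycles in BS *; set t := gen_r swaps cycles in BS *.
pose z := shift_comm a t; pose r := #[pi t].
have r0 : (0 < r)%N by rewrite order_gt0.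
have rF : (r <= #|F|)%N by rewrite -cardsT subset_leq_card ?subsetT.
have piz i : pi (z i) = shift_comm (pi a) (pi t) i.
  rewrite /z -shift_comm_wordE (morph_word_val _ _ _ (@gmulfM _ _ pi)).
  by rewrite shift_comm_wordE.
have piz_mod i : pi (z (i + r * X)%N) = pi (z i).
  by rewrite !piz /shift_comm expgD expgM expg_order expg1n mulg1.
have zz : z (1 + r * X)%N = z (1 + X + r * X)%N.
  apply: coord_eq => j; rewrite !coord_shift_comm; case: (leqP j k) => jk.
    have tX : cycle_perm (period j) ^+ X = 1.
      by rewrite cycle_permX_eq1 ?period_gt1 ?dvdn_period.
    by rewrite /shift_comm mulnC !expgD !expgM tX !expg1n !mulg1.
  have := period_leq jk => jX.
  by rewrite !shift_comm_cycle_eq1 ?period_gt1 //; nia.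
have Bz i : (i <= 1 + X)%N -> word_ball S n (z i).
  by move=> iX; rewrite /z -shift_comm_wordE; apply: BS; rewrite size_shift_comm_word; lia.
have : z 1%N = z (1 + X)%N.
  apply: pi_inj; rewrite ?inE; try by apply: Bz; lia.
  by rewrite -(piz_mod 1%N) zz piz_mod.
(* In coordinate k+1 the element z_(1+X) is trivial but z_1 is not. *)
move=> /(congr1 (coord k.+1)); rewrite !coord_shift_comm.
rewrite [RHS]shift_comm_cycle_eq1 ?period_gt1 //.
- by apply: shift_comm_cycle1_neq1; [exact: period_gt1 | have := period_ge k.+1; lia].
- by lia.
- by nia.
Qed.

(** * Separation of the two growth functions *)

Lemma ceilM_leq (R : realType) (C : R) k n : (0 < C)%R -> (`|Num.ceil C| <= k)%N ->
  (`|Num.ceil (C * n%:R)%R| <= k * n)%N.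
Proof.
move=> C0 Ck.
have ceil0 (x : R) : (0 <= x)%R -> (0 <= Num.ceil x)%R.
  by move=> x0; rewrite ceil_ge0 (lt_le_trans _ x0) // ltrN10.
have Cle : (C <= k%:R)%R.
  apply: le_trans (ceil_ge C) _; rewrite -[(k%:R)%R]/((Posz k)%:~R)%R ler_int.
  by move: (ceil0 C (ltW C0)) Ck; case: (Num.ceil C) => //= c; lia.
have : (Num.ceil (C * n%:R) <= Posz (k * n)%N)%R.
  by rewrite ceil_le_int -[X in (_ <= X)%R]/((k * n)%:R)%R natrM ler_wpM2r ?ler0n.
have := ceil0 (C * n%:R)%R (mulr_ge0 (ltW C0) (ler0n _ _)).
by case: (Num.ceil _) => //= c; lia.
Qed.

(** This is the window for M required by [profile_le_model]; the upper end follows from M <= M! and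
    the factor in [period]. *)
Lemma period_leq_model_degree k : (0 < k)%N ->
  (period k <= model_degree k (period k) <= period k.+1)%N.
Proof.
move=> k0; have X4 := period_ge k; rewrite /=; set X := period k in X4 *.
apply/andP; split.
  have step y : (y <= k * y)%N by rewrite leq_pmull.
  have h : (4 * X + 8 <= k * (k * (k * (4 * X + 8))))%N by do 3 apply: leq_trans (step _) => //.
  by rewrite /model_degree; lia.
set M := model_degree k X.
have MB : (M <= M`! ^ k.+2)%N.
  have MM : (M <= M`!)%N by case: M => // m; rewrite factS leq_pmulr ?fact_gt0.
  by apply: leq_trans MM _; rewrite -[X in (X <= _)%N]expn1 leq_pexp2l ?fact_gt0.
rewrite mulnDr; apply: leq_trans MB _; apply: leq_trans (leq_addr _ _).
by rewrite leq_pmull //; lia.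
Qed.

Lemma rf_growth_not_le (R : realType) (S : set diag_group) : finite_generating_set S ->
  ~ growth_le R (full_rf_growth S) (weakly_sofic_profile R S).
Proof.
move=> genS [C [C0 le_growth]]; have [finS _] := genS.
have [c1 c1P] := word_ball_words (@two_generatedP _ swaps cycles) finS.
have [c2 c2P] := words_word_ball (gen_l swaps cycles) (gen_r swaps cycles) genS.
(* One level k dominates both generating-set constants and C; the radius n then contains all words
   of length 4X + 8. *)
pose k := (c1 + c2 + `|Num.ceil C| + 1)%N.
pose X := period k; pose n := (k * (4 * X + 8))%N; pose n' := `|Num.ceil (C * n%:R)%R|%N.
pose M := model_degree k X.
have k0 : (0 < k)%N by rewrite /k addn1.
have n0 : (0 < n)%N by rewrite /n muln_gt0 k0 addn_gt0 orbT.
have n'k : (n' <= k * n)%N by apply: ceilM_leq => //; rewrite /k; lia.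
have upper : (weakly_sofic_profile R S n' <= M`! ^ k.+2)%N.
  apply: (@profile_le_model _ _ _ (k * n')).
  - move=> g /c1P[w wn gw]; exists w => //; apply: leq_trans wn _.
    by rewrite leq_mul2r /k; lia.
  - by rewrite /M /model_degree -/n leq_add2r !leq_mul2l n'k !orbT.
  - exact: period_leq_model_degree.
have [F [pi [Fn pi_inj]]] := full_rf_growth_attained n finS.
have Fle : (#|F| <= M`! ^ k.+2)%N by rewrite Fn (leq_trans (le_growth n n0)).
have := period_le_quotient (k := k) _ pi_inj.
(* With B the model bound and |F| <= B, the inequality X (B + 5) < (|F| + 1) X + 3 is impossible. *)
rewrite [period k.+1]/= -/X -/M ltnNge => /(_ _)/negP; apply; last first.
  have := period_ge k; rewrite -/X; nia.
move=> w wX; apply: word_ball_leq (c2P w).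
by rewrite /n leq_mul // /k; lia.
Qed.

Theorem corollary1p3 (R : realType) :
  exists G : groupType,
    finitely_generated G /\
    residually_finite G /\
    forall S : set G, finite_generating_set S ->
      growth_le R (weakly_sofic_profile R S) (full_rf_growth S) /\
      ~ growth_equiv R (weakly_sofic_profile R S) (full_rf_growth S).
Proof.
exists diag_group; split; first exact: finitely_generated_diag.
split; first exact: residually_finite_diag.
move=> S genS; split; last by case=> _; apply: rf_growth_not_le.
exists 1%R; split=> [|n _]; first exact: ltr01.
rewrite mul1r -[(n%:R)%R]/((Posz n)%:~R)%R intrKceil absz_nat.
by apply: profile_le_rf_growth; case: genS.
Qed.
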